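(* Let $N_1,N_2>1$ be integers and let $K$ be a differential field of characteristic $p$ ($p=0$ or $p$ prime) with derivation $D$, whose underlying field is infinite and perfect. Let $F$ be a differential field extension of $K$. Let $L_1(Y)$ and $L_2(Y)$ be nonzero homogeneous linear differential polynomials, of orders $N_1$ and $N_2$ respectively, with coefficients in $K$. Let $y\in F$ be nonzero, and suppose that one of the following holds: (1) ($p=0$ or $p>N_1+N_2-2$), and $L_1(y)=L_2(1/y)=0$; (2) ($p=0$ or $p>(q+1)(N_1-1)-1$), where $q$ is a positive integer with $N_2\le q$, and $L_1(y)=L_2(y^q)=0$. Then for each $j=1,\dots,N_1-1$, the element $D^jy/y$ is a root of a nonzero polynomial with coefficients in $K$ of degree at most $$\binom{N_2+N_1-2}{N_1-1}$$ in case (1), and of degree at most $$\binom{q(N_1-1)+N_1-2}{N_1-1}$$ in case (2).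
   Context: A differential field is a field with a single derivation $D$; a differential field extension $F$ of $K$ is a field extension with a derivation on $F$ extending that of $K$, also denoted $D$. A field $K$ is perfect if every irreducible polynomial in $K[x]$ has distinct roots. A homogeneous linear differential polynomial of order $N$ over $K$ is an expression $L(Y)=c_ND^NY+c_{N-1}D^{N-1}Y+\cdots+c_1DY+c_0Y$ with $c_i\in K$ and $c_N\ne0$; $L(y)$ denotes its value at $Y=y$. *)

(* Defs.v *)
From HB Require Import structures.
From mathcomp Require Import all_boot all_order all_algebra all_field.

Set Implicit Arguments.
Unset Strict Implicit.
Unset Printing Implicit Defensive.

Import GRing.Theory.
Local Open Scope ring_scope.

(* Derivations of an arbitrary ring.  The predicate Derivation of
   mathcomp.field.separable only covers linear endomorphisms of a
   finite-dimensional extension, hence derivations trivial on the base. *)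
Definition is_derivation (R : nzRingType) (D : R -> R) : Prop :=
  {morph D : x y / x + y} /\ (forall x y, D (x * y) = D x * y + x * D y).

(* The field embedding iota : K -> F makes (F, DF) a differential field
   extension of (K, DK). *)
Definition differential_extension (K F : fieldType) (DK : K -> K)
    (DF : F -> F) (iota : {rmorphism K -> F}) : Prop :=
  is_derivation DF /\ (forall a, DF (iota a) = iota (DK a)).

Definition has_characteristic (R : nzRingType) (p : nat) : Prop :=
  (p = 0%N /\ [pchar R] =i pred0) \/ p \in [pchar R].

Definition infinite_field (K : fieldType) : Prop :=
  forall s : seq K, exists x, x \notin s.

(* separable_poly f: f has no multiple root in any extension field. *)
Definition perfect_field (K : fieldType) : Prop :=
  forall f : {poly K}, irreducible_poly f -> separable_poly f.

(* Homogeneous linear differential polynomials of order exactly N; the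
   condition on the leading coefficient makes them nonzero. *)
Record ldpoly (K : fieldType) (N : nat) := LDPoly {
  ldcoef :> 'I_N.+1 -> K;
  ldcoef_lead : ldcoef ord_max != 0
}.

Definition ldeval (K F : fieldType) (iota : {rmorphism K -> F}) (DF : F -> F)
    (N : nat) (L : ldpoly K N) (y : F) : F :=
  \sum_(i < N.+1) iota (L i) * iter i DF y.

Definition algebraic_of_degree_le (K F : fieldType) (iota : {rmorphism K -> F})
    (d : nat) (z : F) : Prop :=
  exists P : {poly K},
    [/\ P != 0, ((size P).-1 <= d)%N & root (map_poly iota P) z].

(* Main.v *)
Require Import Defs.
From mathcomp Require Import all_boot all_order all_algebra all_field.
From mathcomp Require Import zify ring.

Set Implicit Arguments.
Unset Strict Implicit.
Unset Printing Implicit Defensive.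

Import GRing.Theory.
Local Open Scope ring_scope.

(** Put n = N1 - 1 and e_i = D^i y / (i! y); the equation L1(y) = 0 makes
    e_1, ..., e_n generate a K-algebra A that contains every D^i y / y (the
    factorials that occur are nonzero by the hypothesis on the
    characteristic).  If A is spanned over K by M elements, then the M + 1
    powers 1, z, ..., z^M of any z in A are linearly dependent over K, so z is a
    root of a nonzero polynomial of degree at most M [kspan_algebraic].  The
    theorem therefore follows once few monomials in the e_i are shown to span
    A.

    Give e_i weight i.  Up to terms of lower weight, D^k x / (k! x) is a
    polynomial in the e_i read off from the generating series
    E(t) = 1 + e_1 t + ... + e_n t^n: it is the k-th coefficient of 1/E for
    x = 1/y, and of E^q for x = y^q.  On the other hand L2(x) = 0 expresses
    D^k x, for every k >= N2, by derivatives of order less than N2, hence of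
    lower weight.  So each of these coefficients is a relation modulo lower
    weight, and it remains to reduce monomials with the help of these relations.

    For x = 1/y, put m = N2.  All coefficients h_k of 1/E with k >= m have
    lower weight: for m <= k <= m + n - 1 by L2, and beyond by the recurrence of
    order n that E H = 1 gives [inverse_coef_vanishing].  For positive
    i_1, ..., i_m, the sum of e_{j_1} ... e_{j_m} h_{|i| - |j|} over all
    j_l < i_l involves only such h_k, whereas E H = 1 shows that it is equal to
    (-1)^m e_{i_1} ... e_{i_m} plus products of fewer than m factors
    [truncs_top].  Hence the monomials of degree at most m - 1 span A, and there
    are binomial(m + n - 1, n) of them [reciprocal_algebraic].

    For x = y^q, the coefficient of t^(q i) in E^q contains e_i^q, and every
    other monomial in it has a larger sum of squares of its indices
    [power_coef_top].  As q i >= q >= N2, the power e_i^q can be rewritten, and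
    the process stops because the sum of squares is bounded for a given weight
    [mspan_count_lt].  Hence the q^n monomials with all exponents less than q
    span A, and q^n is at most the required binomial [exp_le_bin]. *)

(** * Linear spans and algebraic degree *)

Section LinearSpan.

Variables (K F : fieldType) (iota : {rmorphism K -> F}).

Definition kspan (I : finType) (b : I -> F) (x : F) : Prop :=
  exists c : {ffun I -> K}, x = \sum_i iota (c i) * b i.

Section Family.

Variables (I : finType) (b : I -> F).

Lemma kspan0 : kspan b 0.
Proof.
by exists [ffun=> 0]; rewrite big1 // => i _; rewrite ffunE rmorph0 mul0r.
Qed.

Lemma kspanD x z : kspan b x -> kspan b z -> kspan b (x + z).
Proof.
move=> [c ->] [d ->]; exists [ffun i => c i + d i].
rewrite -big_split; apply: eq_bigr => i _.
by rewrite ffunE rmorphD mulrDl.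
Qed.

Lemma kspanZ a x : kspan b x -> kspan b (iota a * x).
Proof.
move=> [c ->]; exists [ffun i => a * c i].
rewrite mulr_sumr; apply: eq_bigr => i _.
by rewrite ffunE rmorphM mulrA.
Qed.

Lemma kspan_sum (J : finType) (x : J -> F) :
  (forall j, kspan b (x j)) -> kspan b (\sum_j x j).
Proof.
move=> hx; elim/big_rec: _ => [|j z _ hz]; first exact: kspan0.
exact: kspanD.
Qed.

Lemma kspan_gen i : kspan b (b i).
Proof.
exists [ffun j => (j == i)%:R].
rewrite (bigD1 i) //= ffunE eqxx rmorph1 mul1r big1 ?addr0 // => j ji.
by rewrite ffunE (negPf ji) rmorph0 mul0r.
Qed.

(** The coordinates of the #|I| + 1 powers 1, z, ..., z^#|I| form a matrix with more
    rows than columns; a vector of its left kernel lists the coefficients of an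
    annihilating polynomial. *)
Lemma kspan_algebraic z :
  (forall k, kspan b (z ^+ k)) -> algebraic_of_degree_le iota #|I| z.
Proof.
move=> hz.
have [c hc] := fin_all_exists (fun k : 'I_#|I|.+1 => hz k).
pose A := \matrix_(k < #|I|.+1, j < #|I|) c k (enum_val j).
have /rowV0Pn[v /sub_kermxP vA v0] : kermx A != 0.
  by rewrite -mxrank_eq0 mxrank_ker -lt0n subn_gt0 ltnS rank_leq_col.
exists (rVpoly v); split.
- by apply: contraNneq v0 => v0; rewrite -[v]rVpolyK v0 linear0.
- by have := size_poly #|I|.+1 (fun k => if insub k is Some i then v 0 i else 0);
    rewrite -/(rVpoly v); case: size.
rewrite /root (@horner_coef_wide _ #|I|.+1); last first.
  by rewrite size_map_poly size_poly.
apply/eqP.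
under eq_bigr => k _ do
  rewrite coef_map /= coef_rVpoly_ord hc mulr_sumr.
rewrite exchange_big big1 //= => i _.
have /matrixP/(_ 0 (enum_rank i)) := vA; rewrite !mxE.
move/(congr1 (fun u => iota u * b i)); rewrite rmorph0 mul0r => vAi.
rewrite -[RHS]vAi rmorph_sum mulr_suml; apply: eq_bigr => k _.
by rewrite !mxE enum_rankK rmorphM mulrA.
Qed.

End Family.

End LinearSpan.

(** * Spans of monomials and rewriting *)

Section MonomialSpan.

Variables (K F : fieldType) (iota : {rmorphism K -> F}) (e : nat -> F).

(** A monomial is encoded by the list of the indices of its factors, so that
    multiplication is concatenation, the number of factors (including e_0) is
    [size] and the weight is [sumn]. *)
Definition mon (s : seq nat) : F := \prod_(i <- s) e i.

(** The K-span of the monomials whose index list satisfies P.  An inductive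
    definition avoids indexing the possibly infinite family of generators. *)
Inductive mspan (P : seq nat -> Prop) : F -> Prop :=
| mspan0 : mspan P 0
| mspan_add a s x : P s -> mspan P x -> mspan P (iota a * mon s + x).

Implicit Types (P Q R : seq nat -> Prop) (s t : seq nat) (x z : F).

Lemma mon_nil : mon [::] = 1.
Proof. by rewrite /mon big_nil. Qed.

Lemma mon_seq1 i : mon [:: i] = e i.
Proof. by rewrite /mon big_seq1. Qed.

Lemma mon_cons i s : mon (i :: s) = e i * mon s.
Proof. by rewrite /mon big_cons. Qed.

Lemma mon_cat s t : mon (s ++ t) = mon s * mon t.
Proof. by rewrite /mon big_cat. Qed.

Lemma mon_perm s t : perm_eq s t -> mon s = mon t.
Proof. by move=> st; apply: perm_big. Qed.

Lemma mon_nseq k i : mon (nseq k i) = e i ^+ k.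
Proof. by elim: k => [|k IH] /=; rewrite ?mon_nil // mon_cons IH exprS. Qed.

Lemma mspanD P x z : mspan P x -> mspan P z -> mspan P (x + z).
Proof.
move=> hx hz; elim: hx => [|a s u Ps _ IH]; first by rewrite add0r.
by rewrite -addrA; apply: mspan_add.
Qed.

Lemma mspanZ P a x : mspan P x -> mspan P (iota a * x).
Proof.
elim=> [|c s u Ps _ IH]; first by rewrite mulr0; apply: mspan0.
by rewrite mulrDr mulrA -rmorphM; apply: mspan_add.
Qed.

Lemma mspanN P x : mspan P x -> mspan P (- x).
Proof. by move/(mspanZ (-1)); rewrite rmorphN1 mulN1r. Qed.

Lemma mspanB P x z : mspan P x -> mspan P z -> mspan P (x - z).
Proof. by move=> hx hz; apply/mspanD/mspanN. Qed.

Lemma mspan_sum P (J : finType) (C : pred J) (x : J -> F) :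
  (forall j, C j -> mspan P (x j)) -> mspan P (\sum_(j | C j) x j).
Proof.
move=> hx; elim/big_rec: _ => [|j z Cj hz]; first exact: mspan0.
by apply: mspanD => //; apply: hx.
Qed.

Lemma mspan_mon P s : P s -> mspan P (mon s).
Proof.
by move=> Ps; have := mspan_add 1 Ps (mspan0 P); rewrite rmorph1 mul1r addr0.
Qed.

Lemma mspan_seq1 i : mspan (eq [:: i]) (e i).
Proof. by rewrite -mon_seq1; apply: mspan_mon. Qed.

Lemma mspan_trans P Q x :
  mspan P x -> (forall s, P s -> mspan Q (mon s)) -> mspan Q x.
Proof.
move=> hx PQ; elim: hx => [|a s u Ps _ IH]; first exact: mspan0.
by apply: mspanD => //; apply: mspanZ; apply: PQ.
Qed.

Lemma mspan_sub P Q x : (forall s, P s -> Q s) -> mspan P x -> mspan Q x.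
Proof. by move=> PQ /mspan_trans; apply=> s /PQ; apply: mspan_mon. Qed.

Lemma mspanM P Q R x z :
  (forall s t, P s -> Q t -> R (s ++ t)) ->
  mspan P x -> mspan Q z -> mspan R (x * z).
Proof.
move=> PQR; elim=> [|a s u Ps _ IH] hz; first by rewrite mul0r; apply: mspan0.
rewrite mulrDl -mulrA; apply: mspanD; last exact: IH.
apply: mspanZ; elim: hz => [|c t w Qt _ IHt]; first by rewrite mulr0; apply: mspan0.
rewrite mulrDr mulrCA -mon_cat; apply: mspanD => //.
by apply/mspanZ/mspan_mon/PQR.
Qed.

Lemma mspan_kspan P (I : finType) (b : I -> F) x :
  mspan P x -> (forall s, P s -> kspan iota b (mon s)) -> kspan iota b x.
Proof.
move=> hx Pb; elim: hx => [|a s u Ps _ IH]; first exact: kspan0.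
by apply: kspanD => //; apply: kspanZ; apply: Pb.
Qed.

(** The order that makes the rewriting terminate: first by weight, then by rk. *)
Definition lower (rk : seq nat -> nat) s t : Prop :=
  (sumn t < sumn s)%N \/ (sumn t = sumn s /\ (rk t < rk s)%N).

(** Normal forms: if every monomial that violates P can be rewritten by smaller
    ones, then the monomials satisfying P span everything. *)
Lemma mspan_reduce P (rk : seq nat -> nat) :
  (forall s, P s \/ mspan (lower rk s) (mon s)) -> forall s, mspan P (mon s).
Proof.
move=> red s; have [N] := ubnP (sumn s); elim: N s => // N IHN s.
have [r] := ubnP (rk s); elim: r s => // r IHr s rs Ns.
case: (red s) => [/mspan_mon // | /mspan_trans]; apply=> t [ts | [ts rt]].
  by apply: IHN; apply: leq_trans ts _.
by apply: IHr; rewrite ?ts //; apply: leq_trans rt _.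
Qed.

End MonomialSpan.

(** * Convolution of coefficient sequences *)

Section Convolution.

Variable F : fieldType.
Implicit Types f g h : nat -> F.

Definition conv f g (k : nat) : F := \sum_(j < k.+1) f j * g (k - j)%N.

Definition delta (k : nat) : F := (k == 0%N)%:R.

Definition trunc (i : nat) f (j : nat) : F := if (j < i)%N then f j else 0.

Lemma eq_conv f g1 g2 : g1 =1 g2 -> conv f g1 =1 conv f g2.
Proof. by move=> g12 k; apply: eq_bigr => j _; rewrite g12. Qed.

(** Power series are truncated to polynomials, which makes the algebra of
    polynomials available for the convolution product. *)
Lemma conv_poly f g k M : (k < M)%N ->
  conv f g k = ((\poly_(i < M) f i) * (\poly_(i < M) g i))`_k.
Proof.
move=> kM; rewrite coefM; apply: eq_bigr => j _; rewrite !coef_poly.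
have -> : (j < M)%N by apply: leq_trans kM; apply: ltn_ord.
by have -> : (k - j < M)%N by apply: leq_ltn_trans kM; apply: leq_subr.
Qed.

Lemma convCA f g h : conv f (conv g h) =1 conv g (conv f h).
Proof.
suff convA (u v w : nat -> F) k :
    conv u (conv v w) k =
    ((\poly_(i < k.+1) u i) * ((\poly_(i < k.+1) v i) * (\poly_(i < k.+1) w i)))`_k.
  by move=> k; rewrite !convA mulrCA.
rewrite coefM; apply: eq_bigr => j _; rewrite coef_poly ltn_ord.
by rewrite (@conv_poly _ _ _ k.+1) // ltnS leq_subr.
Qed.

Lemma conv_recl f g k :
  conv f g k.+1 = f 0%N * g k.+1 + \sum_(j < k.+1) f j.+1 * g (k - j)%N.
Proof. by rewrite /conv big_ord_recl subn0; under eq_bigr => j _ do rewrite subSS. Qed.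

(** The coefficients of 1/f up to degree k, highest first; the whole list is kept
    because each coefficient depends on all previous ones. *)
Fixpoint conv_inv_seq f (k : nat) : seq F :=
  if k is k'.+1 then
    - (\sum_(j < k) f j.+1 * (conv_inv_seq f k')`_j) :: conv_inv_seq f k'
  else [:: 1].

Definition conv_inv f (k : nat) : F := (conv_inv_seq f k)`_0.

Lemma nth_conv_inv_seq f k j :
  (j <= k)%N -> (conv_inv_seq f k)`_j = conv_inv f (k - j).
Proof. by elim: k j => [|k IH] [|j] //= jk; rewrite IH. Qed.

Lemma conv_invr f : f 0%N = 1 -> conv f (conv_inv f) =1 delta.
Proof.
move=> f0 [|k]; first by rewrite /conv big_ord1 f0 mul1r.
rewrite conv_recl f0 mul1r {1}/conv_inv /=.
rewrite [X in - X + _](eq_bigr (fun j : 'I__ => f j.+1 * conv_inv f (k - j))).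
  by rewrite addNr.
by move=> j _; rewrite nth_conv_inv_seq // -ltnS.
Qed.

(** The coefficients of the product of h with the truncations of e below the degrees
    in w: the k-th one is the sum of e_{j_1} ... e_{j_r} h_{k - |j|} over all
    j_l < w_l. *)
Definition conv_truncs e (w : seq nat) h : nat -> F :=
  foldr (fun i => conv (trunc i e)) h w.

Lemma conv_conv_truncs e w h :
  conv e (conv_truncs e w h) =1 conv_truncs e w (conv e h).
Proof.
by elim: w => [|i w IH] //= k; rewrite convCA; apply: eq_conv.
Qed.

Lemma eq_conv_truncs e w h1 h2 :
  h1 =1 h2 -> conv_truncs e w h1 =1 conv_truncs e w h2.
Proof. by move=> h12; elim: w => //= i w IH; apply: eq_conv. Qed.

End Convolution.

(** * The weight filtration *)

Section WeightFiltration.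

Variables (K F : fieldType) (iota : {rmorphism K -> F}) (e : nat -> F).

Local Notation span := (mspan iota e).

Definition wlt (k : nat) (s : seq nat) : Prop := (sumn s < k)%N.
Definition wle (k : nat) (s : seq nat) : Prop := (sumn s <= k)%N.

Lemma mspan_wleS k l x : (k <= l)%N -> span (wle k) x -> span (wle l) x.
Proof. by move=> kl; apply: mspan_sub => s /leq_trans; apply. Qed.

Lemma mspan_wltS k l x : (k <= l)%N -> span (wlt k) x -> span (wlt l) x.
Proof. by move=> kl; apply: mspan_sub => s /leq_trans; apply. Qed.

Lemma mspan_wleW k l x : (k < l)%N -> span (wle k) x -> span (wlt l) x.
Proof. by move=> kl; apply: mspan_sub => s; rewrite /wlt /wle => /leq_ltn_trans; apply. Qed.

Lemma mspan_wltW k x : span (wlt k) x -> span (wle k) x.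
Proof. by apply: mspan_sub => s /ltnW. Qed.

Lemma mspan_e j : span (wle j) (e j).
Proof.
rewrite -(mon_seq1 e).
by apply: mspan_mon; rewrite /wle /= addn0.
Qed.

Lemma mspan_wleM k l x z :
  span (wle k) x -> span (wle l) z -> span (wle (k + l)) (x * z).
Proof. by apply: mspanM => s t hs ht; rewrite /wle sumn_cat leq_add. Qed.

Lemma mspan_wltMl k l x z :
  span (wlt k) x -> span (wle l) z -> span (wlt (k + l)) (x * z).
Proof.
apply: mspanM; rewrite /wlt /wle => s t hs ht.
by rewrite sumn_cat -addSn leq_add.
Qed.

Lemma mspan_wltMr k l x z :
  span (wle k) x -> span (wlt l) z -> span (wlt (k + l)) (x * z).
Proof. by rewrite mulrC addnC => hx hz; apply: mspan_wltMl. Qed.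

Lemma mspan_1 : span (wle 0) 1.
Proof. by rewrite -(mon_nil e); apply: (@mspan_mon _ _ _ _ _ [::]). Qed.

End WeightFiltration.

(** * Relations from the inverse series *)

Section InverseSeries.

Variables (K F : fieldType) (iota : {rmorphism K -> F}) (e h : nat -> F).
Hypotheses (e0 : e 0%N = 1) (eh : conv e h =1 delta F).

Local Notation span := (mspan iota e).

Lemma inverse_coef0 : h 0%N = 1.
Proof. by have := eh 0; rewrite /conv big_ord1 e0 mul1r. Qed.

Lemma inverse_coefS k : h k.+1 = - \sum_(j < k.+1) e j.+1 * h (k - j)%N.
Proof.
by have /eqP := eh k.+1; rewrite conv_recl e0 mul1r addr_eq0 => /eqP.
Qed.

Lemma mspan_inverse_coef k : span (wle k) (h k).
Proof.
have [N] := ubnP k; elim: N k => // N IH [|k] kN.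
  by rewrite inverse_coef0; apply: mspan_1.
rewrite inverse_coefS; apply/mspanN/mspan_sum => j _.
apply: (@mspan_wleS _ _ _ _ (j.+1 + (k - j))); first by have := ltn_ord j; lia.
apply: mspan_wleM; first exact: mspan_e.
by apply: IH; lia.
Qed.

(** As e vanishes beyond n, its inverse h satisfies a linear recurrence of order n:
    n consecutive coefficients of low weight force all later ones to
    have low weight. *)
Lemma inverse_coef_vanishing n m : (0 < m)%N ->
  (forall j, (n < j)%N -> e j = 0) ->
  (forall k, (m <= k < m + n)%N -> span (wlt k) (h k)) ->
  forall k, (m <= k)%N -> span (wlt k) (h k).
Proof.
move=> m0 en hmn k; have [N] := ubnP k; elim: N k => // N IH k kN mk.
have [kmn|mnk] := ltnP k (m + n); first by apply: hmn; rewrite mk.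
case: k => [|k] in kN mk mnk *; first by lia.
rewrite inverse_coefS; apply/mspanN/mspan_sum => j _.
have [jn|nj] := ltnP j n; last by rewrite en // mul0r; apply: mspan0.
apply: (@mspan_wltS _ _ _ _ (j.+1 + (k - j))); first by have := ltn_ord j; lia.
by apply: mspan_wltMr; [exact: mspan_e | apply: IH; lia].
Qed.

Local Notation truncs := (conv_truncs e).

(** With delta = e * h in place of h, only the products of the truncated series are
    left, one factor per entry of w. *)
Lemma mspan_full_truncs w k :
  span (fun s => size s = size w /\ sumn s = k) (truncs w (delta F) k).
Proof.
elim: w k => [|i w IH] k /=.
  rewrite /delta; case: eqP => [->|_]; last exact: mspan0.
  rewrite -(mon_nil e).
  exact: (@mspan_mon _ _ _ _ _ [::]).
apply: mspan_sum => j _; rewrite /trunc; case: ifP => _; last first.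
  by rewrite mul0r; apply: mspan0.
have ej := mspan_seq1 iota e j.
apply: mspanM ej (IH _) => s t <- [ts tk] /=.
by split; rewrite ?ts // tk subnKC // -ltnS ltn_ord.
Qed.

(** By induction on w.  Multiplying by all of E instead of its truncation below i
    replaces h by E H = 1, and so leaves products with one factor less; the
    difference consists of terms e_j with j >= i, and for reasons of weight only
    j = i reproduces the top monomial. *)
Lemma truncs_top w k : (k <= sumn w)%N ->
  span (fun s => (size s < size w)%N /\ sumn s = k)
    (truncs w h k - (-1) ^+ size w * (k == sumn w)%:R * mon e w).
Proof.
elim: w k => [|i w IH] k /=.
  rewrite leqn0 => /eqP ->; rewrite inverse_coef0 /mon big_nil !mulr1 subrr.
  exact: mspan0.
move=> kis.
have -> : conv (trunc i e) (truncs w h) k =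
    truncs w (delta F) k - \sum_(j < k.+1 | (i <= j)%N) e j * truncs w h (k - j)%N.
  rewrite -(eq_conv_truncs _ _ eh) -conv_conv_truncs /conv.
  rewrite (bigID (fun j : 'I__ => (i <= j)%N)) /= big1 ?add0r; last first.
    by move=> j; rewrite leqNgt /trunc => /negPf ->; rewrite mul0r.
  rewrite [in RHS](bigID (fun j : 'I__ => (i <= j)%N)) /= addrAC subrr add0r.
  by apply: eq_bigr => j; rewrite -ltnNge /trunc => ->.
rewrite -addrA -opprD; apply: mspanB.
  apply: mspan_sub (mspan_full_truncs w k) => s [-> ->]; split=> //.
have -> : (-1) ^+ (size w).+1 * (k == (i + sumn w)%N)%:R * mon e (i :: w) =
    - \sum_(j < k.+1 | (i <= j)%N) e j *
        ((-1) ^+ size w * ((k - j)%N == sumn w)%:R * mon e w).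
  rewrite exprS mulN1r !mulNr; congr (- _).
  have [ki|ik] := ltnP k i.
    rewrite big1; last by move=> j; have := ltn_ord j; lia.
    by rewrite (_ : _ == _ = false) ?mulr0 ?mul0r //; apply/eqP; lia.
  have ik1 : (i < k.+1)%N by [].
  rewrite (bigD1 (Ordinal ik1)) //= big1 ?addr0; last first.
    move=> j /andP[ij ji]; rewrite (_ : _ == _ = false) ?(mulr0, mul0r) //.
    have {}ji : (j != i :> nat) by [].
    by apply/eqP; have := ltn_ord j; lia.
  rewrite mon_cons (_ : (k - i == sumn w)%N = (k == (i + sumn w)%N)); first by ring.
  by apply/eqP/eqP; lia.
rewrite -sumrB; apply: mspan_sum => j ij; rewrite -mulrBr.
have ej := mspan_seq1 iota e j.
have /IH : (k - j <= sumn w)%N by lia.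
apply: mspanM ej => s t <- [ts tk] /=.
by split; rewrite ?ltnS // tk subnKC // -ltnS ltn_ord.
Qed.

(** Since j_l <= w_l - 1, every h occurring in the sum has index at least m as soon
    as k is at least m plus the sum of the w_l - 1. *)
Lemma truncs_lower m w k : (forall l, (m <= l)%N -> span (wlt l) (h l)) ->
  (m + sumn (map predn w) <= k)%N -> span (wlt k) (truncs w h k).
Proof.
move=> hm; elim: w k => [|i w IH] k /=; first by rewrite addn0; apply: hm.
move=> mk; apply: mspan_sum => j _; rewrite /trunc.
case: ifP => ji; last by rewrite mul0r; apply: mspan0.
apply: (@mspan_wltS _ _ _ _ (j + (k - j))); first by have := ltn_ord j; lia.
by apply: mspan_wltMr; [exact: mspan_e | apply: IH; lia].
Qed.

(** The product of m factors with positive indices w_1, ..., w_m is rewritten by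
    evaluating the truncated sum at k = |w| in two ways, with [truncs_top] and
    with [truncs_lower]; for that k the bound of the latter is an equality. *)
Lemma mspan_size_lt m : (0 < m)%N ->
  (forall l, (m <= l)%N -> span (wlt l) (h l)) ->
  forall s, span (fun t => (size t < m)%N) (mon e s).
Proof.
move=> m0 hm; apply: (@mspan_reduce _ _ _ _ _ size) => s.
have [sm|ms] := ltnP (size s) m; first by left.
(* A factor e_0 = 1 can be dropped, which lowers the size. *)
right; have [s0|s0] := boolP (0%N \in s).
  rewrite (mon_perm e (perm_to_rem s0)) mon_cons e0 mul1r.
  have /perm_sumn /= sums := perm_to_rem s0.
  apply: mspan_mon; right; rewrite size_rem // sums; split=> //.
  by rewrite prednK // (leq_trans m0).
set w := take m s; set t := drop m s.
have size_is : size w = m by rewrite size_takel.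
have is_pos : (m + sumn (map predn w) <= sumn w)%N.
  have : 0%N \notin w by apply: contra s0 => /mem_take.
  rewrite -size_is; elim: (w) => //= i u IHu.
  by rewrite inE negb_or => /andP[i0 /IHu]; lia.
have topE := truncs_top (leqnn (sumn w)).
have lowE := truncs_lower hm is_pos.
have {topE lowE}redE : span (lower size w) (mon e w).
  have : span (lower size w)
      (truncs w h (sumn w) - (-1) ^+ size w * mon e w).
    by move: topE; rewrite eqxx mulr1; apply: mspan_sub => u [us uk]; right.
  move/(mspanB (mspan_sub (fun u hu => or_introl hu) lowE)).
  rewrite opprB addrCA subrr addr0 => /(mspanZ ((-1) ^+ size w)).
  by rewrite rmorphXn rmorphN1 signrMK.
have et : span (eq t) (mon e t) by apply: mspan_mon.
rewrite -(cat_take_drop m s) mon_cat.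
apply: mspanM redE et => u v hu <-.
by rewrite /lower !sumn_cat !size_cat ltn_add2r ltn_add2r; case: hu => [|[-> ?]]; [left|right].
Qed.

End InverseSeries.

(** * Series that agree up to lower weight *)

(** In the application E is the sequence D^k y / (k! y), and e its
    truncation to indices at most n; the two differ by terms of lower weight
    as long as k! is invertible, that is for k <= B. *)
Section Perturbation.

Variables (K F : fieldType) (iota : {rmorphism K -> F}) (e E : nat -> F).
Variable B : nat.

Local Notation span := (mspan iota e).

Hypothesis eE : forall k, (k <= B)%N -> span (wlt k) (E k - e k).

Lemma mspan_E k : (k <= B)%N -> span (wle k) (E k).
Proof.
move=> kB; rewrite -[E k](subrK (e k)); apply: mspanD; last exact: mspan_e.
exact/mspan_wltW/eE.
Qed.

Lemma inverse_coef_congr (h H : nat -> F) :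
  e 0%N = 1 -> E 0%N = 1 -> conv e h =1 delta F ->
  (forall k, (k <= B)%N -> conv E H k = delta F k) ->
  forall k, (k <= B)%N -> span (wlt k) (H k - h k).
Proof.
move=> e0 E0 eh EH k; have [N] := ubnP k; elim: N k => // N IH [|k] kN kB.
  have := EH _ (leq0n B); rewrite /conv big_ord1 E0 mul1r /delta => ->.
  by rewrite (inverse_coef0 e0 eh) subrr; apply: mspan0.
have HS : H k.+1 = - \sum_(j < k.+1) E j.+1 * H (k - j)%N.
  by have /eqP := EH _ kB; rewrite conv_recl E0 mul1r addr_eq0 => /eqP.
rewrite HS (inverse_coefS e0 eh) -opprD; apply: mspanN.
rewrite -sumrB; apply: mspan_sum => j _.
have jk := ltn_ord j.
have Hh : span (wlt (k - j)) (H (k - j)%N - h (k - j)%N) by apply: IH; lia.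
have -> : E j.+1 * H (k - j)%N - e j.+1 * h (k - j)%N =
    (E j.+1 - e j.+1) * H (k - j)%N + e j.+1 * (H (k - j)%N - h (k - j)%N).
  by ring.
apply: (@mspan_wltS _ _ _ _ (j.+1 + (k - j))); first by lia.
apply: mspanD; last exact: mspan_wltMr (mspan_e _ _ _) Hh.
apply: mspan_wltMl; first by apply: eE; lia.
rewrite -[H _](subrK (h (k - j)%N)); apply: mspanD; first exact: mspan_wltW.
exact: mspan_inverse_coef.
Qed.

Variable G : nat -> nat -> F.
Hypothesis G0 : forall k, (k <= B)%N -> G 0 k = delta F k.
Hypothesis GS : forall r k, (k <= B)%N -> G r.+1 k = conv E (G r) k.

Lemma power_coef r k : (k <= B)%N -> span (wle k) (G r k).
Proof.
elim: r k => [|r IH] k kB.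
  rewrite G0 // /delta; case: eqP => [->|_]; [exact: mspan_1 | exact: mspan0].
rewrite GS //; apply: mspan_sum => j _; have jk := ltn_ord j.
apply: (@mspan_wleS _ _ _ _ (j + (k - j))); first by lia.
by apply: mspan_wleM; [apply: mspan_E | apply: IH]; lia.
Qed.

(** An E-coefficient may be replaced by the e of the same index at the cost of lower
    weight; then the k-th coefficient of the r-th power is the sum of all products
    of r factors of total weight k, and e_i^r is the only one whose indices are
    all equal to i. *)
Lemma power_coef_top i r k : (k <= B)%N ->
  span (fun s => (sumn s < k)%N \/ [/\ size s = r, sumn s = k & s != nseq r i])
    (G r k - (k == (r * i)%N)%:R * e i ^+ r).
Proof.
elim: r k => [|r IH] k kB.
  by rewrite G0 // /delta expr0 mulr1 mul0n subrr; apply: mspan0.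
set P := (P in span P).
have wltP x : span (wlt k) x -> span P x by apply: mspan_sub => s; left.
have termP (j : 'I_k.+1) :
    span P (E j * G r (k - j) -
            (j == i :> nat)%:R * (k == (r.+1 * i)%N)%:R * e i ^+ r.+1).
  have jk : (j <= k)%N by rewrite -ltnS.
  have kE : k = (j + (k - j))%N by rewrite subnKC.
  set g := ((k - j)%N == (r * i)%N)%:R * e i ^+ r.
  have -> : E j * G r (k - j) - (j == i :> nat)%:R * (k == (r.+1 * i)%N)%:R * e i ^+ r.+1 =
      (E j - e j) * G r (k - j) + e j * (G r (k - j) - g) +
      (e j * g - (j == i :> nat)%:R * (k == (r.+1 * i)%N)%:R * e i ^+ r.+1).
    by ring.
  apply: mspanD; first apply: mspanD.
  - apply/wltP/(@mspan_wltS _ _ _ _ (j + (k - j))); first by lia.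
    apply: mspan_wltMl; first by apply: eE; lia.
    by apply: power_coef; lia.
  - have ej := mspan_seq1 iota e j.
    have /IH : (k - j <= B)%N by lia.
    apply: mspanM ej => s t <- /=; rewrite /P /=.
    case=> [tk|[tr tk tn]]; [left; lia | right; split; rewrite ?tr //; first lia].
    by apply: contra tn => /eqP[_ ->].
  - rewrite /g; case: (eqVneq (j : nat) i) => [ji|ji].
      rewrite ji (_ : (k - i == r * i)%N = (k == r.+1 * i)%N); last first.
        by rewrite -{1}(eqn_add2l i) -ji subnKC // ji mulSn.
      by rewrite mul1r exprS mulrCA subrr; apply: mspan0.
    rewrite !mul0r subr0; case: (eqVneq (k - j)%N (r * i)%N) => [kj|_]; last first.
      by rewrite mul0r mulr0; apply: mspan0.
    rewrite mul1r -mon_nseq -mon_cons; apply: mspan_mon; right; split=> /=.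
    + by rewrite size_nseq.
    + by rewrite sumn_nseq mulnC -kj subnKC.
    + by rewrite eqseq_cons (negPf ji).
(* The term e_i^{r+1}, when present, is charged to the summand j = i. *)
rewrite GS // /conv.
have -> : (k == (r.+1 * i)%N)%:R * e i ^+ r.+1 = \sum_(j < k.+1)
    (j == i :> nat)%:R * (k == (r.+1 * i)%N)%:R * e i ^+ r.+1.
  case: (eqVneq k (r.+1 * i)%N) => [kE|_]; last first.
    by rewrite big1 ?mul0r // => j _; rewrite mulr0 mul0r.
  have ik : (i < k.+1)%N by rewrite ltnS kE mulSn leq_addr.
  rewrite (bigD1 (Ordinal ik)) //= eqxx big1 ?mul1r ?addr0 // => j ji.
  by rewrite (_ : _ == _ = false) ?mul0r //; apply/negP => /eqP ji'; case/eqP: ji; apply/val_inj.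
by rewrite -sumrB; apply: mspan_sum.
Qed.

End Perturbation.

(** * Bounding the multiplicity of each factor *)

Definition sumsq (s : seq nat) : nat := sumn [seq (i ^ 2)%N | i <- s].

Lemma sumsq_cat s t : sumsq (s ++ t) = (sumsq s + sumsq t)%N.
Proof. by rewrite /sumsq map_cat sumn_cat. Qed.

Lemma sumsq_le s : (sumsq s <= sumn s ^ 2)%N.
Proof. by rewrite /sumsq; elim: s => //= i s IH; nia. Qed.

(** This says that the sum of (j - i)^2 over the entries j of s is nonnegative; among
    the lists of a given length and sum, constant lists minimise the sum of squares. *)
Lemma sumsq_ge i s : (2 * i * sumn s <= sumsq s + size s * i ^ 2)%N.
Proof.
rewrite /sumsq; elim: s => [|j s IH] /=; first by rewrite muln0.
by have [] := nat_Cauchy i j; nia.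
Qed.

Lemma sumsq_gt i s : s != nseq (size s) i ->
  (2 * i * sumn s < sumsq s + size s * i ^ 2)%N.
Proof.
elim: s => //= j s IH; rewrite eqseq_cons negb_and => /orP[ji|/IH].
  have := sumsq_ge i s; have := ltn_leqif (nat_Cauchy i j).
  by rewrite eq_sym ji /sumsq /=; nia.
by rewrite /sumsq /=; have [] := nat_Cauchy i j; nia.
Qed.

Section BoundedMultiplicity.

Variables (K F : fieldType) (iota : {rmorphism K -> F}) (e : nat -> F).

Local Notation span := (mspan iota e).

(** Decreases when the sum of squares grows at constant weight.  The truncated
    subtraction is harmless by [sumsq_le]. *)
Definition spread (s : seq nat) : nat := (sumn s ^ 2 - sumsq s)%N.

Lemma perm_nseq_cat q i (s : seq nat) : (q <= count_mem i s)%N ->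
  exists t, perm_eq s (nseq q i ++ t).
Proof.
elim: q => [|q IH] qs; first by exists s.
have [t st] := IH (ltnW qs).
have it : i \in t.
  rewrite -has_pred1 has_count; move: qs.
  by rewrite (permP st) count_cat count_nseq /= eqxx; lia.
exists (rem i t); apply: perm_trans st _.
rewrite /= perm_sym -cat1s perm_catCA perm_cat2l /= perm_sym.
exact: perm_to_rem.
Qed.

(** Replacing a block of q equal indices by another list of the same length and sum
    increases the sum of squares. *)
Lemma mspan_count_lt q : (0 < q)%N ->
  (forall i, (0 < i)%N -> span
     (fun s => (sumn s < q * i)%N \/ [/\ size s = q, sumn s = (q * i)%N & s != nseq q i])
     (e i ^+ q)) ->
  forall s, span (fun t => forall i, (0 < i)%N -> (count_mem i t < q)%N) (mon e s).
Proof.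
move=> q0 epow; apply: (@mspan_reduce _ _ _ _ _ spread) => s.
have [sq|] := boolP (all (fun i => (0 < i)%N ==> (count_mem i s < q)%N) s).
  left=> i i0; have [si|/count_memPn -> //] := boolP (i \in s).
  by move/allP: sq => /(_ _ si); rewrite i0.
case/allPn => i _; rewrite negb_imply -leqNgt => /andP[i0 qi]; right.
have [t st] := perm_nseq_cat qi.
have sumE : sumn s = (q * i + sumn t)%N.
  by rewrite (perm_sumn st) sumn_cat sumn_nseq mulnC.
have sqE : sumsq s = (q * i ^ 2 + sumsq t)%N.
  rewrite /sumsq (perm_sumn (perm_map _ st)) map_cat sumn_cat.
  by rewrite map_nseq sumn_nseq mulnC.
rewrite (mon_perm e st) mon_cat mon_nseq.
have et : span (eq t) (mon e t) by apply: mspan_mon.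
apply: mspanM (epow i i0) et => u v hu <-.
rewrite /lower /spread !sumn_cat sumsq_cat sumE sqE.
case: hu => [hu|[uq uk un]]; [left; lia | right; split; first lia].
have := @sumsq_gt i u; rewrite uq uk => /(_ un) lt_sq.
have := @sumsq_le (u ++ t); rewrite sumsq_cat sumn_cat uk.
nia.
Qed.

End BoundedMultiplicity.

(** * Normalised divided derivatives *)

Section DividedDerivatives.

Variables (F : fieldType) (D : F -> F).
Hypothesis hD : is_derivation D.

Lemma derivation0 : D 0 = 0.
Proof. by apply: (addrI (D 0)); rewrite -hD.1 !addr0. Qed.

Lemma derivation1 : D 1 = 0.
Proof. by apply: (addrI (D 1)); rewrite -[in RHS](mulr1 1) hD.2 mulr1 mul1r addr0. Qed.

Lemma derivationMn x k : D (x *+ k) = D x *+ k.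
Proof. by elim: k => [|k IH]; rewrite ?mulr0n ?derivation0 // !mulrS hD.1 IH. Qed.

Lemma derivation_sum (I : finType) (x : I -> F) : D (\sum_i x i) = \sum_i D (x i).
Proof. exact: (big_morph D hD.1 derivation0). Qed.

Lemma iter_derivation0 k : iter k D 0 = 0.
Proof. by elim: k => //= k ->; apply: derivation0. Qed.

Lemma iter_derivationM k x z :
  iter k D (x * z) = \sum_(j < k.+1) (iter j D x * iter (k - j) D z) *+ 'C(k, j).
Proof.
elim: k => [|k IH]; first by rewrite big_ord1 bin0.
rewrite iterS IH derivation_sum.
under eq_bigr => j _ do rewrite derivationMn hD.2 mulrnDl.
rewrite big_split /= [RHS]big_ord_recl /= bin0 ?subn0.
under [X in _ = _ + X]eq_bigr => j _ do rewrite binS mulrnDr subSS.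
rewrite big_split /= addrA [LHS]addrC; congr (_ + _).
rewrite big_ord_recl [in RHS]big_ord_recr /= (bin_small (ltnSn k)) mulr0n addr0 bin0 subn0.
congr (_ + _); apply: eq_bigr => j _.
by rewrite /bump /= add1n -[D (iter _ D z)]iterS subnSK.
Qed.

(** The Taylor coefficients of x, divided by x.  This normalisation turns products of
    functions into convolutions [ndiffM]. *)
Definition ndiff (x : F) (k : nat) : F := iter k D x / (k`!%:R * x).

Lemma ndiff0 x : x != 0 -> ndiff x 0 = 1.
Proof. by move=> x0; rewrite /ndiff mul1r divff. Qed.

Lemma ndiff1 k : ndiff 1 k = delta F k.
Proof.
case: k => [|k]; first by rewrite ndiff0 ?oner_eq0.
by rewrite /ndiff iterSr derivation1 iter_derivation0 mul0r.
Qed.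

Lemma ndiffM x z k : x != 0 -> z != 0 -> k`!%:R != 0 :> F ->
  ndiff (x * z) k = conv (ndiff x) (ndiff z) k.
Proof.
move=> x0 z0 k0; rewrite /ndiff iter_derivationM mulr_suml; apply: eq_bigr => j _.
have jk : (j <= k)%N by rewrite -ltnS.
have := bin_fact jk => /(congr1 (fun i => i%:R : F)); rewrite !natrM => kE.
have := k0; rewrite -kE !mulf_eq0 !negb_or => /and3P[c0 j0 kj0].
rewrite -mulr_natr; field.
by rewrite x0 z0 c0 j0 kj0.
Qed.

End DividedDerivatives.

Lemma fact_neq0_le (F : fieldType) k l :
  (k <= l)%N -> l`!%:R != 0 :> F -> k`!%:R != 0 :> F.
Proof.
by move=> kl; rewrite -(bin_fact kl) !natrM !mulf_eq0 !negb_or => /and3P[].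
Qed.

(** * Consequences of the linear differential equations *)

Section LinearEquation.

Variables (K F : fieldType) (DK : K -> K) (D : F -> F) (iota : {rmorphism K -> F}).
Hypothesis hF : differential_extension DK D iota.

Let hD : is_derivation D := hF.1.

(** The span of x, ..., D^(N-1) x is stable under D, because the leading coefficient
    of L is invertible. *)
Lemma iter_kspan N (L : ldpoly K N) (x : F) : (0 < N)%N ->
  ldeval iota D L x = 0 ->
  forall k, kspan iota (fun i : 'I_N => iter i D x) (iter k D x).
Proof.
move=> N0 Lx; set b := fun i : 'I_N => _.
have bN : kspan iota b (iter N D x).
  move: Lx; rewrite /ldeval big_ord_recr /= addrC => /eqP; rewrite addr_eq0 => /eqP LN.
  have -> : iter N D x =
      \sum_(i < N) iota (- (L (widen_ord (leqnSn N) i) / L ord_max)) * b i.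
    have l0 : iota (L ord_max) != 0 by rewrite fmorph_eq0 ldcoef_lead.
    apply: (mulfI l0); rewrite LN mulr_sumr -sumrN; apply: eq_bigr => i _.
    by rewrite rmorphN fmorph_div mulNr mulrN mulrA [iota _ * (_ / _)]mulrC divfK.
  by apply: kspan_sum => i; apply/kspanZ/kspan_gen.
elim=> [|k [c kE]]; first exact: (kspan_gen iota b (Ordinal N0)).
rewrite iterS kE (derivation_sum hD); apply: kspan_sum => i.
rewrite hD.2 hF.2; apply: kspanD; apply: kspanZ; first exact: kspan_gen.
have [iN|] := ltnP i.+1 N; first exact: (kspan_gen iota b (Ordinal iN)).
rewrite leq_eqVlt ltnNge (ltn_ord i) orbF => /eqP iN.
by rewrite -iterS -iN.
Qed.

Lemma ndiff_kspan N (L : ldpoly K N) (x : F) k : (0 < N <= k)%N ->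
  ldeval iota D L x = 0 -> x != 0 -> k`!%:R != 0 :> F ->
  kspan iota (fun i : 'I_N => ndiff D x i) (ndiff D x k).
Proof.
move=> /andP[N0 Nk] Lx x0 k0; have [c kE] := iter_kspan N0 Lx k.
exists [ffun i : 'I_N => c i * (i`!%:R / k`!%:R)].
rewrite {1}/ndiff kE mulr_suml; apply: eq_bigr => i _.
have i0 : i`!%:R != 0 :> F by apply: fact_neq0_le k0; have := ltn_ord i; lia.
rewrite ffunE rmorphM fmorph_div !rmorph_nat /ndiff; field.
by rewrite x0 i0 k0.
Qed.

(** A relation L(x) = 0 lowers the weight of all derivatives of order at least N. *)
Lemma ndiff_mspan (e : nat -> F) N (L : ldpoly K N) (x : F) k : (0 < N <= k)%N ->
  ldeval iota D L x = 0 -> x != 0 -> k`!%:R != 0 :> F ->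
  (forall i, (i < N)%N -> mspan iota e (wle i) (ndiff D x i)) ->
  mspan iota e (wlt k) (ndiff D x k).
Proof.
move=> Nk Lx x0 k0 low; have [c ->] := ndiff_kspan Nk Lx x0 k0.
apply: mspan_sum => i _; apply/mspanZ/(@mspan_wleW _ _ _ _ i); last exact: low.
by have := ltn_ord i; lia.
Qed.

Variables (n : nat) (L1 : ldpoly K n.+1) (y : F).
Hypotheses (y0 : y != 0) (L1y : ldeval iota D L1 y = 0).

Definition coord (j : nat) : F := if (j <= n)%N then ndiff D y j else 0.

Local Notation span := (mspan iota coord).

Lemma coord0 : coord 0 = 1.
Proof. by rewrite /coord /= ndiff0. Qed.

Lemma coord_gt j : (n < j)%N -> coord j = 0.
Proof. by rewrite /coord ltnNge => /negPf ->. Qed.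

Lemma mon_coord_gt s : ~~ all (leq^~ n) s -> mon coord s = 0.
Proof.
case/allPn => j js; rewrite -ltnNge => nj.
by rewrite (mon_perm _ (perm_to_rem js)) mon_cons coord_gt // mul0r.
Qed.

(** For k > n the left side is a combination of the e_i with i <= n. *)
Lemma ndiff_coord k : k`!%:R != 0 :> F -> span (wlt k) (ndiff D y k - coord k).
Proof.
move=> k0; rewrite {2}/coord; case: leqP => [kn|nk].
  by rewrite subrr; apply: mspan0.
rewrite subr0; apply: ndiff_mspan L1y y0 k0 _ => // i i_n.
have -> : ndiff D y i = coord i by rewrite /coord -ltnS i_n.
exact: mspan_e.
Qed.

Lemma algebraic_of_mspan (P : seq nat -> Prop) (I : finType) (b : I -> F) j :
  (j <= n)%N -> n`!%:R != 0 :> F ->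
  (forall s, span P (mon coord s)) ->
  (forall s, P s -> all (leq^~ n) s -> exists i, mon coord s = b i) ->
  algebraic_of_degree_le iota #|I| (iter j D y / y).
Proof.
move=> jn n0 hP hb; apply: (@kspan_algebraic _ _ _ _ b) => k.
have j0 : j`!%:R != 0 :> F by apply: fact_neq0_le n0.
have -> : iter j D y / y = iota j`!%:R * coord j.
  by rewrite rmorph_nat /coord jn /ndiff; field; rewrite ?y0 ?j0.
rewrite exprMn -rmorphXn -(mon_nseq coord); apply: kspanZ.
apply: (mspan_kspan (hP _)) => s Ps.
have [s_n|/mon_coord_gt ->] := boolP (all (leq^~ n) s); last exact: kspan0.
by have [i ->] := hb s Ps s_n; apply: kspan_gen.
Qed.

(** The monomials of degree less than m in e_1, ..., e_n become, after padding with
    e_0 = 1, the monomials of degree m - 1 in e_0, ..., e_n, which are counted by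
    sorted tuples. *)
Lemma reciprocal_algebraic m (L2 : ldpoly K m) j : (0 < m)%N ->
  (m + n - 1)`!%:R != 0 :> F -> ldeval iota D L2 y^-1 = 0 -> (j <= n)%N ->
  algebraic_of_degree_le iota 'C(m + n - 1, n) (iter j D y / y).
Proof.
case: m L2 => // m L2 _; rewrite addSn subn1 /= => B0 L2y jn.
have y1 : y^-1 != 0 by rewrite invr_eq0.
have fact0 k : (k <= m + n)%N -> k`!%:R != 0 :> F.
  by move=> kB; apply: fact_neq0_le B0.
set H := ndiff D y^-1; set h := conv_inv coord.
have eh : conv coord h =1 delta F by apply/conv_invr/coord0.
have hE k (kB : (k <= m + n)%N) := ndiff_coord (fact0 k kB).
have EH k : (k <= m + n)%N -> conv (ndiff D y) H k = delta F k.
  by move=> kB; rewrite -(ndiffM hD) ?fact0 // divff // (ndiff1 hD).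
have Hh := inverse_coef_congr hE coord0 (ndiff0 D y0) eh EH.
have Hle k : (k <= m + n)%N -> span (wle k) (H k).
  move=> kB; rewrite -[H k](subrK (h k)); apply: mspanD; first exact/mspan_wltW/Hh.
  exact: mspan_inverse_coef coord0 eh _.
have hlt k : (m < k)%N -> span (wlt k) (h k).
  apply: (@inverse_coef_vanishing _ _ iota _ _ coord0 eh n m.+1) => // [i|l /andP[ml lB]].
    exact: coord_gt.
  rewrite -[h l](subKr (H l)); apply: mspanB; last by apply: Hh; lia.
  have {}lB : (l <= m + n)%N by lia.
  apply: (ndiff_mspan _ L2y y1 (fact0 _ lB)) => // i im.
  by apply: Hle; lia.
have small := mspan_size_lt coord0 eh (ltn0Sn m) hlt.
pose A := [set t : m.-tuple 'I_n.+1 | sorted leq (map val t)].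
pose I := {t | t \in A} : finType.
have -> : 'C(m + n, n) = #|I|.
  by rewrite card_sig card_sorted_tuples -bin_sub ?leq_addl // addnK.
apply: (algebraic_of_mspan (b := fun t : I => mon coord (map val (sval t))) jn _ small).
  by apply: fact0; lia.
move=> s sm s_n; pose u := sort leq (nseq (m - size s) 0%N ++ s).
have su : perm_eq u (nseq (m - size s) 0%N ++ s) by apply/permPl/perm_sort.
have size_u : size u = m.
  by rewrite (perm_size su) size_cat size_nseq subnK.
have u_n : all (leq^~ n) u.
  by rewrite (perm_all _ su) all_cat s_n all_nseq leq0n orbT.
have size_t : size [seq inord i : 'I_n.+1 | i <- u] == m by rewrite size_map size_u.
have valt : map val (Tuple size_t) = u.
  rewrite /= -map_comp map_id_in // => i iu /=.
  by rewrite inordK // ltnS; move/allP: u_n => /(_ i iu).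
have tA : Tuple size_t \in A by rewrite inE valt sort_sorted //; apply: leq_total.
exists (exist _ (Tuple size_t) tA); rewrite [sval _]/= valt (mon_perm _ su).
by rewrite mon_cat mon_nseq coord0 expr1n mul1r.
Qed.

Lemma mon_count s : all (leq^~ n) s ->
  mon coord s = \prod_(i < n) coord i.+1 ^+ count_mem i.+1 s.
Proof.
elim: s => [|j s IH] /=; first by rewrite mon_nil big1.
move=> /andP[jn /IH sE]; rewrite mon_cons sE.
under [RHS]eq_bigr => i _ do rewrite exprD.
rewrite big_split /=; congr (_ * _).
case: j jn => [|j] jn; first by rewrite coord0 big1.
rewrite (bigD1 (Ordinal jn)) //= eqxx big1 ?mulr1 // => i ij.
by rewrite (_ : (j.+1 == i.+1) = false) //; apply/eqP => -[ji]; case/eqP: ij; apply/val_inj.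
Qed.

Lemma power_algebraic m (L2 : ldpoly K m) q j : (0 < m <= q)%N ->
  (q * n)`!%:R != 0 :> F -> ldeval iota D L2 (y ^+ q) = 0 -> (j <= n)%N ->
  algebraic_of_degree_le iota (q ^ n) (iter j D y / y).
Proof.
move=> /andP[m0 mq] B0 L2y jn.
have q0 : (0 < q)%N by apply: leq_trans mq.
have fact0 k : (k <= q * n)%N -> k`!%:R != 0 :> F.
  by move=> kB; apply: fact_neq0_le B0.
pose G r := ndiff D (y ^+ r).
have G0 k : (k <= q * n)%N -> G 0%N k = delta F k.
  by move=> _; rewrite /G expr0 (ndiff1 hD).
have GS r k : (k <= q * n)%N -> G r.+1 k = conv (ndiff D y) (G r) k.
  by move=> kB; rewrite /G exprS (ndiffM hD) ?expf_neq0 ?fact0.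
have eE k (kB : (k <= q * n)%N) := ndiff_coord (fact0 k kB).
have small := @mspan_count_lt _ _ iota coord q q0 _.
pose b (f : {ffun 'I_n -> 'I_q}) := \prod_(i < n) coord i.+1 ^+ f i.
have -> : (q ^ n)%N = #|{ffun 'I_n -> 'I_q}| by rewrite card_ffun !card_ord.
apply: (algebraic_of_mspan (b := b) jn _ (small _)); first by apply: fact0; nia.
  move=> i i0; have [ni|i_n] := ltnP n i.
    by rewrite coord_gt // expr0n -[q == _]negbK -lt0n q0; apply: mspan0.
  have iB : (q * i <= q * n)%N by rewrite leq_mul2l i_n orbT.
  have top := power_coef_top eE G0 GS i q iB.
  rewrite eqxx mul1r in top.
  rewrite -[_ ^+ _](subKr (G q (q * i)%N)); apply: mspanB top.
  have : span (wlt (q * i)) (G q (q * i)%N).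
    apply: ndiff_mspan L2y _ (fact0 _ iB) _; first by nia.
      exact: expf_neq0.
    by move=> l lm; apply: (power_coef eE G0 GS); nia.
  by apply: mspan_sub => s; left.
move=> s sq s_n; exists [ffun i : 'I_n => Ordinal (sq i.+1 isT)].
by rewrite mon_count //; apply: eq_bigr => i _; rewrite ffunE.
Qed.

End LinearEquation.

(** Compare n! q^n = prod_i q (n - i) factor by factor with the falling factorial
    prod_i (q n + n - 1 - i). *)
Lemma exp_le_bin q n : (0 < q)%N -> (q ^ n <= 'C(q * n + n - 1, n))%N.
Proof.
move=> q0; rewrite -(leq_pmul2r (fact_gt0 n)) bin_ffact.
have -> : (q ^ n * n`! = \prod_(i < n) (q * (n - i)))%N.
  by rewrite big_split /= prod_nat_const card_ord -ffactnn ffact_prod.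
rewrite ffact_prod; apply: leq_prod => i _; have := ltn_ord i; nia.
Qed.

Lemma algebraic_of_degree_leW (K F : fieldType) (iota : {rmorphism K -> F}) d d' z :
  (d <= d')%N -> algebraic_of_degree_le iota d z -> algebraic_of_degree_le iota d' z.
Proof. by move=> dd [P [P0 Pd Pz]]; exists P; split=> //; apply: leq_trans dd. Qed.

Lemma fact_neq0_char (K F : fieldType) (iota : {rmorphism K -> F}) p N :
  has_characteristic K p -> (p = 0 \/ N < p)%N -> N`!%:R != 0 :> F.
Proof.
move=> hp pN; rewrite -(rmorph_nat iota) fmorph_eq0.
elim: N pN => [|N IH] pN; first exact: oner_neq0.
rewrite factS natrM mulf_neq0 ?IH //; last by case: pN => [|/ltnW]; [left | right].
case: hp => [[_ /pcharf0P ->] // | pK]; rewrite -(dvdn_pcharf pK).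
have [p0|Np] := pN; first by have := pcharf_prime pK; rewrite p0.
by rewrite gtnNdvd.
Qed.

Theorem mainTheorem4 (N1 N2 : nat) (hN1 : (1 < N1)%N) (hN2 : (1 < N2)%N)
  (K : fieldType) (DK : K -> K) (hDK : is_derivation DK)
  (p : nat) (hp : has_characteristic K p)
  (hinf : infinite_field K) (hperf : perfect_field K)
  (F : fieldType) (DF : F -> F) (iota : {rmorphism K -> F})
  (hF : differential_extension DK DF iota)
  (L1 : ldpoly K N1) (L2 : ldpoly K N2)
  (y : F) (hy : y != 0) :
  ((p = 0%N \/ (N1 + N2 - 2 < p)%N) ->
   ldeval iota DF L1 y = 0 -> ldeval iota DF L2 y^-1 = 0 ->
   forall j : nat, (1 <= j <= N1 - 1)%N ->
     algebraic_of_degree_le iota 'C(N2 + N1 - 2, N1 - 1) (iter j DF y / y))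
  /\
  (forall q : nat, (0 < q)%N -> (N2 <= q)%N ->
   (p = 0%N \/ ((q + 1) * (N1 - 1) - 1 < p)%N) ->
   ldeval iota DF L1 y = 0 -> ldeval iota DF L2 (y ^+ q) = 0 ->
   forall j : nat, (1 <= j <= N1 - 1)%N ->
     algebraic_of_degree_le iota 'C(q * (N1 - 1) + N1 - 2, N1 - 1)
       (iter j DF y / y)).
Proof.
case: N1 hN1 L1 => // n n0 L1; rewrite subn1 /=.
split=> [pB L1y L2y j /andP[_ jn] | q q0 N2q pB L1y L2y j /andP[_ jn]].
  have -> : (N2 + n.+1 - 2 = N2 + n - 1)%N by lia.
  apply: (reciprocal_algebraic hF hy L1y _ _ L2y jn); first by lia.
  apply: (fact_neq0_char iota hp).
  by case: pB => [|pB]; [left | right; lia].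
have -> : (q * n + n.+1 - 2 = q * n + n - 1)%N by lia.
apply: (algebraic_of_degree_leW (exp_le_bin n q0)).
apply: (power_algebraic hF hy L1y _ _ L2y jn); first by lia.
apply: (fact_neq0_char iota hp).
by case: pB => [|pB]; [left | right; nia].
Qed.
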